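(* Let $\mathcal{K}:V\to A$ be a relative averaging operator on an almost Poisson algebra $(A,\cdot,[\cdot,\cdot])$ with respect to a representation $(V,\mu,\rho)$. Then $V$ with the operations $$u\cdot_{\mathcal{K}}v=\mu(\mathcal{K}(u))v,\qquad \{u,v\}_{\mathcal{K}}=\rho(\mathcal{K}(u))v,\qquad u,v\in V,$$ is an $\mathsf{AWB}$ (algebra with bracket).
   Context: All vector spaces are finite dimensional over a field $\mathbb{K}$ of characteristic zero. An almost Poisson algebra $(A,\cdot,[\cdot,\cdot])$ is a vector space with a commutative associative bilinear product $\cdot$ and a skew-symmetric bilinear bracket satisfying $[x,y\cdot z]=[x,y]\cdot z+y\cdot[x,z]$ (no Jacobi identity is assumed). A representation $(V,\mu,\rho)$ of it is a vector space $V$ with linear maps $\mu,\rho:A\to\mathrm{End}(V)$ such that $\mu(x\cdot y)=\mu(x)\mu(y)$, $\rho(x\cdot y)=\mu(y)\rho(x)+\mu(x)\rho(y)$ and $\mu([x,y])=\rho(x)\mu(y)-\mu(y)\rho(x)$ for all $x,y\in A$. A relative averaging operator on $(A,\cdot,[\cdot,\cdot])$ with respect to $(V,\mu,\rho)$ is a linear map $\mathcal{K}:V\to A$ such that for all $u,v\in V$: $\mathcal{K}(u)\cdot\mathcal{K}(v)=\mathcal{K}(\mu(\mathcal{K}(u))v)$ and $[\mathcal{K}(u),\mathcal{K}(v)]=\mathcal{K}(\rho(\mathcal{K}(u))v)$. An $\mathsf{AWB}$ $(B,\cdot,\{\cdot,\cdot\})$ is an associative algebra $(B,\cdot)$ (not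 necessarily commutative) with a bilinear bracket (not necessarily skew-symmetric) satisfying $\{x,y\cdot z\}=\{x,y\}\cdot z+y\cdot\{x,z\}$ for all $x,y,z\in B$. *)

(* Defs.v *)
From mathcomp Require Import all_boot all_order all_algebra.

Set Implicit Arguments.
Unset Strict Implicit.
Unset Printing Implicit Defensive.

Import GRing.Theory.
Local Open Scope ring_scope.

Section Definitions.

Variable F : fieldType.

Section Algebras.

Variable A : vectType F.

Definition leibniz (mul br : A -> A -> A) : Prop :=
  forall x y z, br x (mul y z) = mul (br x y) z + mul y (br x z).

Record is_almost_poisson (mul br : A -> A -> A) : Prop := IsAlmostPoisson {
  ap_mul_bilinear : bilinear_for *:%R *:%R mul;
  ap_mulC : commutative mul;
  ap_mulA : associative mul;
  ap_br_bilinear : bilinear_for *:%R *:%R br;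
  ap_br_skew : forall x y, br x y = - br y x;
  ap_leibniz : leibniz mul br
}.

Record is_awb (mul br : A -> A -> A) : Prop := IsAWB {
  awb_mul_bilinear : bilinear_for *:%R *:%R mul;
  awb_mulA : associative mul;
  awb_br_bilinear : bilinear_for *:%R *:%R br;
  awb_leibniz : leibniz mul br
}.

End Algebras.

Variables A V : vectType F.

Record is_representation (mul br : A -> A -> A)
    (mu rho : {linear A -> 'End(V)}) : Prop := IsRepresentation {
  rep_mu_mul : forall x y, mu (mul x y) = (mu x \o mu y)%VF;
  rep_rho_mul : forall x y,
    rho (mul x y) = (mu y \o rho x)%VF + (mu x \o rho y)%VF;
  rep_mu_br : forall x y,
    mu (br x y) = (rho x \o mu y)%VF - (mu y \o rho x)%VF
}.

Record is_relative_averaging (mul br : A -> A -> A)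
    (mu rho : {linear A -> 'End(V)}) (K : 'Hom(V, A)) : Prop :=
  IsRelativeAveraging {
  ravg_mul : forall u v, mul (K u) (K v) = K (mu (K u) v);
  ravg_br : forall u v, br (K u) (K v) = K (rho (K u) v)
}.

End Definitions.

(* Main.v *)
Require Import Defs.
From mathcomp Require Import all_boot all_order all_algebra.

(** Both operations on [V] have the form [(u, v) |-> phi (K u) v] for a linear
    map [phi] into [End V], hence are bilinear.  The averaging identities turn
    the action of [K (mu (K u) v)] and [K (rho (K u) v)] into that of
    [mul (K u) (K v)] and [br (K u) (K v)].  So associativity on [V] is the
    multiplicativity of [mu], and the Leibniz rule on [V] is the formula
    expressing [mu (br x y)] as the commutator of [rho x] and [mu y]. *)

Import GRing.Theory.
Local Open Scope ring_scope.

Lemma bilinear_action_comp (F : fieldType) (A V : vectType F)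
    (phi : {linear A -> 'End(V)}) (K : 'Hom(V, A)) :
  bilinear_for *:%R *:%R (fun u v : V => phi (K u) v).
Proof.
split=> [v a u1 u2|u a v1 v2] /=; last by rewrite linearP.
by rewrite !linearP add_lfunE scale_lfunE.
Qed.

Theorem theorem5p19 (F : fieldType) (charF0 : [pchar F] =i pred0)
    (A V : vectType F) (mul br : A -> A -> A)
    (mu rho : {linear A -> 'End(V)}) (K : 'Hom(V, A))
    (hA : is_almost_poisson mul br)
    (hV : is_representation mul br mu rho)
    (hK : is_relative_averaging mul br mu rho K) :
  is_awb (fun u v : V => mu (K u) v) (fun u v : V => rho (K u) v).
Proof.
case: hV => mu_mul _ mu_br; case: hK => K_mul K_br.
split; try exact: bilinear_action_comp.
  by move=> u v w; rewrite -K_mul mu_mul comp_lfunE.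
move=> u v w.
by rewrite -K_br mu_br add_lfunE opp_lfunE !comp_lfunE subrK.
Qed.
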